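(* If $\pi,\pi'\in S_n$ satisfy $\pi'\le_{\mathrm{left}}\pi$, then $|s^{-1}(\pi')|\ge|s^{-1}(\pi)|$.
   Context: $S_n$ is the set of permutations of $[n]$ in one-line notation. The stack-sorting map $s$: $s$ of the empty permutation is empty, and if $\pi=LmR$ with $m$ the largest entry, then $s(\pi)=s(L)s(R)m$; $s^{-1}(\pi)=\{\tau\in S_n:s(\tau)=\pi\}$. For $\tau\in S_n$ and $i\in[n-1]$, $\widetilde t_i(\tau)$ is obtained by swapping the positions of $i$ and $i+1$ if $i+1$ appears to the left of $i$ in $\tau$, and $\widetilde t_i(\tau)=\tau$ otherwise. The left weak order is defined by $\pi'\le_{\mathrm{left}}\pi$ iff there is a sequence $i_1,\dots,i_m\in[n-1]$ with $\widetilde t_{i_m}\circ\cdots\circ\widetilde t_{i_1}(\pi)=\pi'$. *)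

(* Defs.v *)
From mathcomp Require Import all_boot all_fingroup.

Set Implicit Arguments.
Unset Strict Implicit.
Unset Printing Implicit Defensive.

(* [n] is modelled by 'I_n = {0, ..., n-1}, so the letter k of the usual
   convention is the ordinal k-1; everything below depends only on the relative
   order of the letters. *)
Definition oneline n (pi : 'S_n) : seq nat := [seq val (pi i) | i <- enum 'I_n].

Definition wmax (w : seq nat) : nat := foldr maxn 0 w.

(* k is fuel bounding the length of w; see stack_sort_cat for the recursion
   s(LmR) = s(L)s(R)m. *)
Fixpoint stack_sort_rec (k : nat) (w : seq nat) : seq nat :=
  match k, w with
  | k'.+1, _ :: _ =>
      let m := wmax w in
      let L := take (index m w) w in
      let R := drop (index m w).+1 w in
      stack_sort_rec k' L ++ stack_sort_rec k' R ++ [:: m]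
  | _, _ => [::]
  end.

Definition stack_sort (w : seq nat) : seq nat := stack_sort_rec (size w) w.

Definition stack_preim n (pi : 'S_n) : {set 'S_n} :=
  [set tau : 'S_n | stack_sort (oneline tau) == oneline pi].

Definition ord_lo n (i : 'I_n.-1) : 'I_n := widen_ord (leq_pred n) i.

Lemma ord_hi_proof n (i : 'I_n.-1) : i.+1 < n.
Proof. by case: n i => [|n] [i lt_i]. Qed.

Definition ord_hi n (i : 'I_n.-1) : 'I_n := Ordinal (ord_hi_proof i).

(* Permutations compose left to right: (tau * tperm a b) x = tperm a b (tau x),
   which exchanges the letters (not the positions) a and b; tau^-1 a is the
   position of the letter a. *)
Definition ttilde n (i : 'I_n.-1) (tau : 'S_n) : 'S_n :=
  (if tau^-1 (ord_hi i) < tau^-1 (ord_lo i)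
   then tau * tperm (ord_lo i) (ord_hi i) else tau)%g.

Definition left_weak_le n (pi' pi : 'S_n) : Prop :=
  exists s : seq 'I_n.-1, foldl (fun tau i => ttilde i tau) pi s = pi'.

Lemma stack_sort_rec_fuel k w :
  size w <= k -> stack_sort_rec k w = stack_sort w.
Proof.
suff eq_rec j l v : size v <= j -> size v <= l ->
    stack_sort_rec j v = stack_sort_rec l v by move=> h; exact: eq_rec.
elim: j l v => [|j IHj] [|l] [|a v] //= le_j le_l.
have le_ind : index (wmax (a :: v)) (a :: v) <= size v.
  have : wmax (a :: v) \in a :: v.
    elim: (v) (a) => [|b u IHu] c; first by rewrite /wmax /= maxn0 mem_head.
    have -> : wmax [:: c, b & u] = maxn c (wmax (b :: u)) by [].
    by case: leqP => _; rewrite inE ?eqxx // IHu orbT.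
  by rewrite -index_mem ltnS.
have le_take : size (take (index (wmax (a :: v)) (a :: v)) (a :: v)) <= size v.
  by rewrite size_take_min (leq_trans (geq_minl _ _)).
have le_drop : size (drop (index (wmax (a :: v)) (a :: v)) v) <= size v.
  by rewrite size_drop leq_subr.
by congr (_ ++ (_ ++ _)); apply: IHj; apply: leq_trans; eassumption.
Qed.

Lemma stack_sort_cat (L R : seq nat) m :
  all (ltn^~ m) L -> all (ltn^~ m) R ->
  stack_sort (L ++ m :: R) = stack_sort L ++ stack_sort R ++ [:: m].
Proof.
move=> ltL ltR.
have maxE w : all (ltn^~ m) w -> wmax w <= m.
  by elim: w => //= x w IH /andP[/ltnW lt_x /IH]; rewrite geq_max lt_x.
have wm : wmax (L ++ m :: R) = m.
  rewrite /wmax; elim: L ltL => [_|x L IH] /=; first exact/maxn_idPl/maxE.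
  by case/andP=> /ltnW lt_x /IH ->; apply/maxn_idPr.
have mL : m \notin L.
  by apply/negP => /(allP ltL); rewrite /= ltnn.
have ind : index m (L ++ m :: R) = size L.
  by rewrite index_cat (negbTE mL) /= eqxx addn0.
have step k w : w != [::] -> stack_sort_rec k.+1 w =
    stack_sort_rec k (take (index (wmax w) w) w) ++
    stack_sort_rec k (drop (index (wmax w) w).+1 w) ++ [:: wmax w].
  by case: w.
rewrite {1}/stack_sort size_cat addnS step; last by case: (L).
rewrite wm ind take_size_cat // drop_cat ltnNge leqnSn /= subSnn /= drop0.
by rewrite !stack_sort_rec_fuel ?leq_addr ?leq_addl.
Qed.

(* Main.v *)
Require Import Defs.
From mathcomp Require Import all_boot all_fingroup zify.

(** It suffices to treat one exchange of the letters [a] and [a+1], where [a+1]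
    precedes [a] in [s(tau)].  In that case, whenever the recursion
    [s(LmR) = s(L)s(R)m] reaches a word containing both letters, its maximum
    [m] is larger than both; so the two letters are never compared with each
    other, and exchanging them commutes with [s] at [tau].  Exchanging the two
    letters thus injects [s^-1(pi)] into [s^-1(ttilde_a(pi))]. *)

(** Induction along the recursion of $s$: a nonempty word is cut at its largest letter, which is
    strictly largest because letters do not repeat. *)
Lemma max_split_ind (P : seq nat -> Prop) :
  P [::] ->
  (forall L m R, uniq (L ++ m :: R) -> all (ltn^~ m) L -> all (ltn^~ m) R ->
     P L -> P R -> P (L ++ m :: R)) ->
  forall w, uniq w -> P w.
Proof.
move=> P0 PS w; have [k] := ubnP (size w).
elim: k w => // k IHk [|x w0] // size_w uniq_w.
have [m m_w max_m] : exists2 m, m \in x :: w0 & all (leq^~ m) (x :: w0).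
  elim: (w0) (x) => [|z v IHv] y; first by exists y; rewrite ?mem_head //= leqnn.
  have [m m_v max_m] := IHv z; have [le_ym|lt_my] := leqP y m.
    by exists m; [rewrite in_cons m_v orbT | rewrite /= le_ym].
  exists y; rewrite ?mem_head //= leqnn /=.
  by apply: sub_all max_m => t /= /leq_trans -> //; apply: ltnW.
move: (x :: w0) size_w uniq_w m_w max_m => w size_w uniq_w m_w.
case/splitPr: m_w size_w uniq_w => L R size_w uniq_w.
rewrite all_cat /= => /and3P[maxL _ maxR].
move: (uniq_w); rewrite cat_uniq /= negb_or => /and3P[uL /andP[mL _] /andP[mR uR]].
have lt_m v : m \notin v -> all (leq^~ m) v -> all (ltn^~ m) v.
  move=> mv /allP max_v; apply/allP => y y_v /=; rewrite ltn_neqAle max_v // andbT.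
  by apply: contraNneq mv => <-.
move: size_w; rewrite size_cat /= addnS ltnS => size_w.
apply: PS => //; try exact: lt_m.
  by apply: IHk => //; apply: leq_ltn_trans size_w; exact: leq_addr.
by apply: IHk => //; apply: leq_ltn_trans size_w; exact: leq_addl.
Qed.

Lemma perm_stack_sort w : uniq w -> perm_eq (stack_sort w) w.
Proof.
move: w; apply: max_split_ind => // L m R _ ltL ltR permL permR.
rewrite stack_sort_cat // perm_cat // -[m :: R]cat1s perm_sym perm_catC.
by rewrite perm_cat2r perm_sym.
Qed.

(** Acts on all of [nat], so that it also applies to the subwords met in the recursion, which may
    contain only one of the two letters. *)
Definition swap_letters (a x : nat) : nat :=
  if x == a then a.+1 else if x == a.+1 then a else x.

(** The letters [a] and [a.+1] are adjacent values, so the only strict inequality that their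
    exchange can break is the one between them. *)
Lemma swap_letters_lt a x m :
  x < m -> ~~ ((x == a) && (m == a.+1)) -> swap_letters a x < swap_letters a m.
Proof. by rewrite /swap_letters; do !case: eqP => ? /=; lia. Qed.

(** The exchange keeps the maximum in place, so both words split at the same position. The order
    condition is guarded by membership so that [L] and [R] inherit it. *)
Lemma stack_sort_swap a w : uniq w ->
    (a \in w -> a.+1 \in w ->
     index a.+1 (stack_sort w) < index a (stack_sort w)) ->
  stack_sort (map (swap_letters a) w) = map (swap_letters a) (stack_sort w).
Proof.
move: w; apply: max_split_ind => // L m R uniq_w ltL ltR IHL IHR.
rewrite stack_sort_cat // => before.
move: (uniq_w); rewrite cat_uniq /= negb_or => /and3P[uL /andP[mL LR] /andP[mR uR]].
have memL : stack_sort L =i L by apply: perm_mem; exact: perm_stack_sort.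
have memR : stack_sort R =i R by apply: perm_mem; exact: perm_stack_sort.
have notL x : x \in R -> x \notin L.
  by move=> xR; apply: contra LR => xL; apply/hasP; exists x.
(* If [m] were [a.+1] with [a] in [L] or [R], then [a.+1] would end the sorted word and so follow
   [a], against [before]. *)
have max_neq x : x \in L ++ R -> ~~ ((x == a) && (m == a.+1)).
  move=> aw; apply/negP => /andP[/eqP xa /eqP ma]; subst x m.
  have a_s : a \in stack_sort L ++ stack_sort R by rewrite mem_cat memL memR -mem_cat.
  have b_s : a.+1 \notin stack_sort L ++ stack_sort R.
    by rewrite mem_cat memL memR negb_or mL.
  move: before; rewrite catA !(index_cat _ (_ ++ _)) a_s (negbTE b_s) /= eqxx addn0.
  rewrite ltnNge ltnW ?index_mem // => before; suff: false by [].
  apply: before; rewrite mem_cat inE ?eqxx ?orbT //.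
  by move: aw; rewrite mem_cat => /orP[] ->; rewrite ?orbT.
have swap_lt v : {subset v <= L ++ R} -> all (ltn^~ m) v ->
    all (ltn^~ (swap_letters a m)) (map (swap_letters a) v).
  move=> v_w /allP lt_v; rewrite all_map; apply/allP => x xv /=.
  by apply: swap_letters_lt; [exact: lt_v | exact/max_neq/v_w].
rewrite map_cat /= stack_sort_cat; first last.
- by apply: swap_lt => // x xR; rewrite mem_cat xR orbT.
- by apply: swap_lt => // x xL; rewrite mem_cat xL.
rewrite IHL ?IHR ?map_cat //.
(* Both letters lie in [R]: their positions in the sorted word are those in [stack_sort R], shifted
   by the same amount. *)
- move=> aR bR; move: before; rewrite !index_cat !memL !memR.
  rewrite (negbTE (notL _ aR)) (negbTE (notL _ bR)) aR bR ltn_add2l.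
  by apply; rewrite mem_cat inE ?aR ?bR !orbT.
- move=> aL bL; move: before; rewrite !index_cat !memL aL bL.
  by apply; rewrite mem_cat ?aL ?bL.
Qed.

Lemma uniq_oneline n (pi : 'S_n) : uniq (oneline pi).
Proof.
by rewrite /oneline map_inj_uniq ?enum_uniq // => i j /val_inj /perm_inj.
Qed.

(** Translates the test made by [ttilde] into the order condition of [stack_sort_swap]. *)
Lemma index_oneline n (pi : 'S_n) (x : 'I_n) :
  index (val x) (oneline pi) = (pi^-1)%g x.
Proof.
rewrite -[x in LHS](permKV pi) /oneline.
rewrite (@index_map _ _ (fun i => val (pi i))); last first.
  by move=> i j /val_inj /perm_inj.
by rewrite index_enum_ord.
Qed.

Lemma oneline_swap n (i : 'I_n.-1) (tau : 'S_n) :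
  oneline (tau * tperm (ord_lo i) (ord_hi i))%g =
  map (swap_letters i) (oneline tau).
Proof.
rewrite /oneline -map_comp; apply: eq_map => j /=; rewrite permM /swap_letters.
case: tpermP => [->|->|/eqP + /eqP] /=; rewrite ?eqxx //.
  by case: eqP => //; lia.
by rewrite -!val_eqE /= => /negbTE-> /negbTE->.
Qed.

Lemma card_stack_preim_ttilde n (i : 'I_n.-1) (pi : 'S_n) :
  #|stack_preim pi| <= #|stack_preim (ttilde i pi)|.
Proof.
rewrite /ttilde; case: ifP => // before.
(* Right multiplication by the transposition is injective, so it remains to see that it maps one
   preimage set into the other. *)
rewrite -(card_imset _ (mulIg (tperm (ord_lo i) (ord_hi i)))).
apply/subset_leq_card/subsetP => _ /imsetP[tau + ->].
rewrite !inE => /eqP s_tau; rewrite !oneline_swap stack_sort_swap.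
- by rewrite s_tau.
- exact: uniq_oneline.
- move=> _ _; rewrite s_tau.
  by rewrite (index_oneline _ _ (ord_hi i)) (index_oneline _ _ (ord_lo i)).
Qed.

Theorem theorem3p3 (n : nat) (pi pi' : 'S_n) (hle : left_weak_le pi' pi) :
  #|stack_preim pi'| >= #|stack_preim pi|.
Proof.
case: hle => s <-; elim: s pi => //= i s IHs pi.
exact: leq_trans (card_stack_preim_ttilde _ i pi) (IHs _).
Qed.
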